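(* Let $(X,\tau,g)$ be a first countable premetric space. Suppose that for every proper, lower semicontinuous and bounded below function $f:X\to\mathbb{R}\cup\{+\infty\}$ satisfying the condition $$\text{for each }x\in X\text{ with }f(x)>\inf_X f\text{ there exists }y\in X,\ y\neq x,\text{ such that } g(y,x)\le f(x)-f(y),$$ there exists $v\in X$ such that $f(v)=\inf_X f$. Then $(X,\tau,g)$ is $\Sigma_g$-semicomplete.
   Context: $\mathbb{R}^+=[0,\infty)$. A premetric space $(X,\tau,g)$ is a first countable topological space $(X,\tau)$ with a premetric function $g:X\times X\to\mathbb{R}^+$, i.e. (P1) $g(x,x)=0$ for all $x\in X$ and $g(x,y)>0$ whenever $x\neq y$; (P2) $g(x,\cdot)$ is continuous for every fixed $x\in X$. (No symmetry or triangle inequality is assumed.) A sequence $\{x_n\}_{n\ge0}$ in $X$ is $\Sigma_g$-Cauchy if its $g$-length $\sum_{i=0}^\infty g(x_{i+1},x_i)$ is finite. $(X,\tau,g)$ is called $\Sigma_g$-semicomplete if every $\Sigma_g$-Cauchy sequence in $X$ has a convergent subsequence. Proper means $f$ is not identically $+\infty$. If $f(x)=+\infty$ and $f(y)<+\infty$, then $f(x)-f(y)=+\infty$. *)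

(* Defs.v *)
From HB Require Import structures.
From mathcomp Require Import all_boot all_order all_algebra.
From mathcomp Require Import all_classical all_reals all_analysis.

Set Implicit Arguments.
Unset Strict Implicit.
Unset Printing Implicit Defensive.

Import Order.TTheory GRing.Theory Num.Theory.
Import numFieldNormedType.Exports.

Local Open Scope classical_set_scope.
Local Open Scope ring_scope.

Definition first_countable (X : topologicalType) : Prop :=
  forall x : X, exists B : set (set X),
    [/\ countable B, B `<=` nbhs x & filter_from B id --> x].

Record is_premetric (R : realType) (X : topologicalType) (g : X -> X -> R) :
    Prop := IsPremetric {
  premetric_ge0 : forall x y, 0 <= g x y ;
  premetric_refl : forall x, g x x = 0 ;
  premetric_gt0 : forall x y, x <> y -> 0 < g x y ;
  premetric_continuous : forall x, continuous (g x)
}.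

(* Note the order of the arguments of g, which is not symmetric. *)
Definition glength (R : realType) (X : Type) (g : X -> X -> R)
    (u : nat -> X) : \bar R :=
  (\sum_(0 <= i <oo) (g (u i.+1) (u i))%:E)%E.

Definition Sigma_cauchy (R : realType) (X : Type) (g : X -> X -> R)
    (u : nat -> X) : Prop :=
  (glength g u < +oo)%E.

(* The limit is quantified explicitly: cvgn would require X to be pointed,
   hence nonempty. *)
Definition Sigma_semicomplete (R : realType) (X : topologicalType)
    (g : X -> X -> R) : Prop :=
  forall u : nat -> X, Sigma_cauchy g u ->
    exists2 phi : nat -> nat, increasing_seq phi &
      exists l : X, u \o phi @ \oo --> l.

(* Functions X -> R \cup {+oo} are functions to \bar R that avoid -oo. *)
Definition avoids_ninfty (R : realType) (X : Type) (f : X -> \bar R) : Prop :=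
  forall x, f x != -oo%E.

Definition proper_efun (R : realType) (X : Type) (f : X -> \bar R) : Prop :=
  ~ (forall x, f x = +oo%E).

Definition bounded_below (R : realType) (X : Type) (f : X -> \bar R) : Prop :=
  exists M : R, forall x, (M%:E <= f x)%E.

(* If f x = +oo and f y < +oo, then f x - f y = +oo and the inequality holds.
   If f y = +oo, then f x - f y = -oo in \bar R (even when f x = +oo), so the
   inequality fails: y necessarily lies in the effective domain of f. *)
Definition descent_condition (R : realType) (X : Type) (g : X -> X -> R)
    (f : X -> \bar R) : Prop :=
  forall x, (ereal_inf (range f) < f x)%E ->
    exists2 y, y <> x & ((g y x)%:E <= f x - f y)%E.

(* Main.v *)
(* If a Sigma_g-Cauchy sequence u has no convergent subsequence, then by first
   countability every point has a neighborhood that contains u n for only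
   finitely many n. The tail lengths T n, transported to X by
   f x = inf {T n | u n = x} (+oo off the range of u), then form a lower
   semicontinuous function that has no minimum: if N is the last index with
   u N = x, then f x = T N, and passing from x to u N.+1 lowers f by at least
   g (u N.+1) (u N) > 0. This contradicts the hypothesis on minima. *)
Require Import Defs.
From HB Require Import structures.
From mathcomp Require Import all_boot all_order all_algebra.
From mathcomp Require Import all_classical all_reals all_analysis.

Set Implicit Arguments.
Unset Strict Implicit.
Unset Printing Implicit Defensive.

Import Order.TTheory GRing.Theory Num.Theory.
Import numFieldNormedType.Exports.

Local Open Scope classical_set_scope.
Local Open Scope ring_scope.

Lemma first_countable_nested_basis (X : topologicalType) (x : X) :
  first_countable X ->
  exists W : nat -> set X, (forall n, nbhs x (W n)) /\
    forall A, nbhs x A -> exists N, forall n, (N <= n)%N -> W n `<=` A.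
Proof.
move=> /(_ x)[B [/countable_injP[h hinj] Bx Bcvg]].
(* [W n] is the intersection of the basic sets with code below [n]. As [h] is injective on [B], each
   step adds at most one set, so [W n] remains a neighborhood of [x]. *)
exists (fun n => [set y | forall b, B b -> (h b < n)%N -> b y]); split.
  elim=> [|n IHn]; first by apply: filterS filterT => y _ b.
  have [[b [Bb hb]]|nob] := pselect (exists b, B b /\ h b = n).
    apply: filterS (filterI IHn (Bx b Bb)) => y [Wy by_] c Bc.
    rewrite ltnS leq_eqVlt => /predU1P[hc|]; last exact: Wy.
    suff -> : c = b by [].
    by apply: hinj; rewrite ?inE// hc hb.
  apply: filterS IHn => y Wy b Bb.
  rewrite ltnS leq_eqVlt => /predU1P[hb|]; last exact: Wy.
  by case: nob; exists b.
move=> A /Bcvg[b Bb bA]; exists (h b).+1 => n hn y Wy.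
by apply: bA; exact: Wy.
Qed.

Lemma first_countable_subseq_cvg (X : topologicalType) (u : nat -> X) (x : X) :
  first_countable X ->
  (forall A m, nbhs x A -> exists2 n, (m <= n)%N & A (u n)) ->
  exists2 phi : nat -> nat, increasing_seq phi & u \o phi @ \oo --> x.
Proof.
move=> /first_countable_nested_basis -/(_ x)[W [Wx WA]] clu.
have /choice[c cP] : forall p : nat * nat,
    exists q, (p.2 <= q)%N /\ W p.1 (u q).
  by move=> [n m]; have [q mq Wq] := clu (W n) m (Wx n); exists q.
(* The argument [(phi n').+1] forces strict increase; the argument [n] puts [u (phi n)] in [W n]. *)
pose phi := fix phi n :=
  if n is n'.+1 then c (n, (phi n').+1) else c (0, 0)%N.
exists phi; first by apply/increasing_seqP => n; exact: (cP (_, _)).1.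
move=> A /WA[N WNA]; exists N => // n /= /WNA; apply.
by case: n => [|n]; exact: (cP (_, _)).2.
Qed.

(** Positivity of [g y] off [y] is an open condition that separates points. This makes finite sets
    closed, as semicontinuity of [tail_fun] requires. *)
Lemma premetric_accessible (R : realType) (X : topologicalType)
  (g : X -> X -> R) : is_premetric g -> accessible_space X.
Proof.
move=> hg x y /eqP xy; exists [set z | 0 < g y z]; split.
- apply: (@open_comp _ _ (g y) [set r | 0 < r]); last exact: open_gt.
  by move=> z _; exact: (premetric_continuous hg).
- by rewrite inE; apply: (premetric_gt0 hg) => /esym.
- by rewrite inE /= (premetric_refl hg) ltxx.
Qed.

Section tail_length.
Variables (R : realType) (X : topologicalType) (g : X -> X -> R).
Variable u : nat -> X.
Hypotheses (hg : is_premetric g) (uC : Sigma_cauchy g u).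
Local Open Scope ereal_scope.

Definition tail_length n := \sum_(n <= i <oo) (g (u i.+1) (u i))%:E.

Lemma tail_length_ge0 n : 0 <= tail_length n.
Proof. by apply: nneseries_ge0 => i _ _; rewrite lee_fin (premetric_ge0 hg). Qed.

Lemma tail_lengthS n :
  tail_length n = (g (u n.+1) (u n))%:E + tail_length n.+1.
Proof.
rewrite /tail_length (nneseries_split n 1) ?addn1 ?big_nat1// => i _.
by rewrite lee_fin (premetric_ge0 hg).
Qed.

Lemma tail_length_nonincreasing m n :
  (m <= n)%N -> tail_length n <= tail_length m.
Proof.
move=> /subnK <-; elim: (n - m)%N => [|k IHk] //.
apply: le_trans IHk; rewrite addSn (tail_lengthS (k + m)).
by rewrite leeDr// lee_fin (premetric_ge0 hg).
Qed.

Lemma tail_length_fin_num n : tail_length n \is a fin_num.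
Proof.
rewrite ge0_fin_numE ?tail_length_ge0//.
exact: le_lt_trans (tail_length_nonincreasing (leq0n n)) uC.
Qed.

Definition tail_fun x := ereal_inf (tail_length @` [set n | u n = x]).

Lemma tail_fun_ge0 x : 0 <= tail_fun x.
Proof. by apply/ereal_infP => _ [n _ <-]; exact: tail_length_ge0. Qed.

Lemma tail_fun_le n : tail_fun (u n) <= tail_length n.
Proof. by apply: ereal_inf_lbound; exists n. Qed.

Lemma tail_fun_pinfty x : (forall n, u n <> x) -> tail_fun x = +oo.
Proof.
move=> xu; rewrite /tail_fun (_ : [set n | _] = set0) ?image_set0 ?ereal_inf0//.
by apply/seteqP; split=> n //= /xu.
Qed.

Lemma tail_fun_last n :
  (forall m, u m = u n -> (m <= n)%N) -> tail_fun (u n) = tail_length n.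
Proof.
move=> lastn; apply/eqP; rewrite eq_le tail_fun_le/=.
apply/ereal_infP => _ [m /= /lastn mn <-].
exact: tail_length_nonincreasing.
Qed.

Hypothesis u_locfin : forall x : X, exists2 A, nbhs x A &
  exists N, forall n, (N <= n)%N -> ~ A (u n).

(** Local finiteness at the point [u n] itself bounds the indices at which this value recurs. *)
Lemma exists_last_index n :
  exists N, u N = u n /\ forall m, u m = u N -> (m <= N)%N.
Proof.
have [A nA [M AM]] := u_locfin (u n).
have exP : exists i, `[< u i = u n >] by exists n; apply/asboolP.
have ubP i : `[< u i = u n >] -> (i <= M)%N.
  move=> /asboolP uin; rewrite leqNgt; apply/negP => /ltnW/AM.
  by rewrite uin; apply; exact: nbhs_singleton.
case: (ex_maxnP exP ubP) => N /asboolP uN maxN; exists N; split=> // m.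
by rewrite uN => um; apply: maxN; apply/asboolP.
Qed.

Lemma lower_semicontinuous_tail_fun : lower_semicontinuous tail_fun.
Proof.
move=> x a ax; have [A nA [N AN]] := u_locfin x.
(* Only terms of index below [N] can meet [A]. Deleting those distinct from [x] leaves a
   neighborhood where [tail_fun] is [+oo] except perhaps at [x]. *)
pose F := (u @` `I_N) `\ x.
have Fclosed : closed F.
  apply: (accessible_finite_set_closed.1 (premetric_accessible hg)).
  by apply: finite_setD; apply: finite_image; exact: finite_II.
exists (A `&` ~` F).
  apply: filterI nA _; apply: open_nbhs_nbhs.
  by split; [exact: closed_openC|move=> [_]; exact].
move=> y [Ay Fy]; have [->//|yx] := eqVneq y x.
rewrite tail_fun_pinfty ?ltry// => n uny.
have [/AN|nN] := leqP N n; first by rewrite uny.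
by apply: Fy; split; [exists n|apply/eqP].
Qed.

Lemma tail_fun_descent n : exists2 y, y <> u n &
  tail_fun y < tail_fun (u n) /\
  (g y (u n))%:E <= tail_fun (u n) - tail_fun y.
Proof.
have [N [<- lastN]] := exists_last_index n.
have uSN : u N.+1 <> u N by move=> /lastN; rewrite ltnn.
have g0 := premetric_gt0 hg uSN.
have fS := tail_fun_le N.+1.
have fSfin : tail_fun (u N.+1) \is a fin_num.
  rewrite ge0_fin_numE ?tail_fun_ge0// (le_lt_trans fS)//.
  by rewrite -ge0_fin_numE ?tail_length_ge0 ?tail_length_fin_num.
(* The value [u N.+1] may recur later, so only [fS] is available; this upper bound suffices for both
   inequalities. *)
exists (u N.+1) => //; rewrite (tail_fun_last lastN) tail_lengthS; split.
  by rewrite (le_lt_trans fS)// lteDr ?tail_length_fin_num// lte_fin.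
by rewrite leeBrDr// leeD2l.
Qed.

Lemma tail_fun_descent_condition : descent_condition g tail_fun.
Proof.
move=> x _; have [[n <-]|xu] := pselect (exists n, u n = x).
  by have [y yx []] := tail_fun_descent n; exists y.
have {}xu n : u n <> x by move=> unx; apply: xu; exists n.
(* Off the range of [u] the difference is [+oo], because [tail_fun (u 0)] is finite. *)
exists (u 0%N) => //; rewrite tail_fun_pinfty// addye ?leey//.
by rewrite eqe_oppLR/= lt_eqF// (le_lt_trans (tail_fun_le 0%N) uC).
Qed.

(** On the range of [u] the descent is strict; off it the value [+oo] exceeds the finite
    [tail_fun (u 0)]. *)
Lemma tail_fun_no_min v : tail_fun v <> ereal_inf (range tail_fun).
Proof.
move=> vmin; have minv y : tail_fun v <= tail_fun y.
  by rewrite vmin; apply: ereal_inf_lbound; exists y.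
have [[n unv]|vu] := pselect (exists n, u n = v).
  have [y _ []] := tail_fun_descent n.
  by rewrite unv ltNge minv.
have := le_trans (minv (u 0%N)) (tail_fun_le 0%N).
rewrite tail_fun_pinfty => [|n unv]; last by apply: vu; exists n.
by rewrite leye_eq => /eqP T0; have := tail_length_fin_num 0; rewrite T0.
Qed.

End tail_length.

Theorem theorem3p8 (R : realType) (X : topologicalType) (g : X -> X -> R)
    (hX : first_countable X) (hg : is_premetric g)
    (hmin : forall f : X -> \bar R,
      avoids_ninfty f -> proper_efun f -> lower_semicontinuous f ->
      bounded_below f -> descent_condition g f ->
      exists v : X, f v = ereal_inf (range f)) :
  Sigma_semicomplete g.
Proof.
move=> u uC; apply: contrapT => nocvg.
(* If this fails at [x], every neighborhood of [x] contains terms of arbitrarily large index, which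
   yields a subsequence converging to [x]. *)
have u_locfin (x : X) : exists2 A, nbhs x A &
    exists N, forall n, (N <= n)%N -> ~ A (u n).
  apply: contrapT => nolf; apply: nocvg.
  have [A m nA|phi phi_inc phi_cvg] := @first_countable_subseq_cvg _ u x hX.
    apply: contrapT => noA; apply: nolf; exists A => //.
    by exists m => n mn An; apply: noA; exists n.
  by exists phi => //; exists x.
have [|||||v] := hmin (tail_fun g u).
- by move=> x; rewrite gt_eqF// (lt_le_trans _ (tail_fun_ge0 u hg x)).
- move=> /(_ (u 0%N)) f0; have := tail_fun_le g u 0.
  by rewrite f0 leye_eq => /eqP T0; have := tail_length_fin_num hg uC 0;
    rewrite T0.
- exact: lower_semicontinuous_tail_fun.
- by exists 0 => x; exact: tail_fun_ge0.
- exact: tail_fun_descent_condition.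
- exact: tail_fun_no_min.
Qed.
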